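(* Let $n \ge s \ge 1$ be integers. Then $$\varepsilon_s - \frac{\sqrt{2\pi}\,e^{\frac{1}{12s}}}{3\sqrt{s}} + \frac{\sqrt{2\pi}\,e^{\frac{1}{12s}}}{3\sqrt{n}} \;\le\; \varepsilon_n \;\le\; \varepsilon_s - \frac{\sqrt{2\pi}\,e^{\frac{1}{12s+1}-\frac{1}{8s}}}{3\sqrt{s}} + \frac{\sqrt{2\pi}\,e^{\frac{1}{12s+1}-\frac{1}{8s}}}{3\sqrt{n}}.$$
   Context: For $x>1$, $\operatorname{li}(x)=\int_0^x \frac{dt}{\ln(t)}$ denotes the logarithmic integral (with the integral across the singularity $t=1$ understood as a Cauchy principal value). For real $x\ge e$, the Stieltjes approximation of $\operatorname{li}(x)$ is $$\operatorname{li}_{*}(x) = \frac{(\ln(x)-n^{*})\,x\,n^{*}!}{\ln^{n^{*}+1}(x)} + \frac{x}{\ln(x)} \sum_{k=0}^{n^{*}-1} \frac{k!}{\ln^{k}(x)}, \qquad n^{*}=\lfloor \ln(x)\rfloor,$$ where $\ln^m(x)$ means $(\ln x)^m$. The Stieltjes approximation error is $\varepsilon(x)=\operatorname{li}_{*}(x)-\operatorname{li}(x)$ for $x\ge e$, and $\varepsilon_k = \varepsilon(e^k)$ for integers $k\ge 1$. *)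

(* Defs.v *)
(* Stdlib reals with Coquelicot. *)
From Stdlib Require Import Reals Factorial.
From Coquelicot Require Import Coquelicot.

Open Scope R_scope.

(* The integrand 1/ln t is bounded near 0 and tends to 0 there; with Stdlib's
   conventions [ln 0 = 0] and [/ 0 = 0] it is continuous at 0, so the integral
   over [0, 1 - d] is a proper Riemann integral for 0 < d < 1. *)
Definition li_truncated (x d : R) : R :=
  RInt (fun t => / ln t) 0 (1 - d) + RInt (fun t => / ln t) (1 + d) x.

(* Logarithmic integral for x > 1: the Cauchy principal value at t = 1, i.e.
   the limit of [li_truncated x d] as d tends to 0 from above. *)
Definition li (x : R) : R :=
  iota (fun l : R => filterlim (li_truncated x) (at_right 0) (locally l)).

(* [Int_part] is the floor function; [Z.to_nat] loses nothing when x >= e,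
   where the floor is at least 1. *)
Definition n_star (x : R) : nat := Z.to_nat (Int_part (ln x)).

(* Meant for x >= e. [sum_f_R0 f m] is f 0 + ... + f m, so the sum ranges over
   0 <= k <= n_star x - 1. *)
Definition li_star (x : R) : R :=
  (ln x - INR (n_star x)) * x * INR (fact (n_star x)) / ln x ^ (n_star x + 1)
  + x / ln x * sum_f_R0 (fun k => INR (fact k) / ln x ^ k) (n_star x - 1).

Definition stieltjes_error (x : R) : R := li_star x - li x.

Definition stieltjes_error_seq (k : nat) : R := stieltjes_error (exp (INR k)).

(* Main.v *)
Require Import Defs.
From Stdlib Require Import Reals Factorial ZArith Lra Lia.
From Coquelicot Require Import Coquelicot.

(* Integrating by parts, [eps_n - eps_(n+1)] is
   [n! * int_n^(n+1) (t - n) (n + 1 - t) exp t / t^(n+2) dt], and [t = n w^2] turns it into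
   [2 n C * int_1^y (w^2 - 1) (y^2 - w^2) / w^2 * exp g dw] with [C = n! e^n / n^n],
   [y = sqrt (1 + 1/n)] and [g = n (w^2 - 1) - (2 n + 1) ln w], where [g <= 0].
   Robbins' form of Stirling's formula estimates [C]. The upper bound uses [exp g <= 1];
   the lower one uses [exp g >= e^(-1/(8n)) (1 + g + 1/(8n))], the tangent at the approximate
   minimum of [g]. Both integrals then have explicit primitives. Finally, the bounds are
   summed over the steps from [s] to [n], the exponentials being monotone in [n]. *)

(** * Elementary inequalities for the logarithm *)

(** Serves the logarithm inequalities and also the comparison of integrals, which are handled
    through primitives. *)
Lemma le_of_derive_nonneg (f df : R -> R) (a b : R) :
  a <= b -> (forall x, a <= x <= b -> is_derive f x (df x)) ->
  (forall x, a <= x <= b -> 0 <= df x) -> f a <= f b.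
Proof.
  intros hab hd hp.
  destruct (MVT_gen f a b df) as [c [hc e]];
    rewrite ?Rmin_left, ?Rmax_right in * by lra.
  - intros x hx. apply hd. lra.
  - intros x hx. apply derivable_continuous_pt, ex_derive_Reals_0.
    exists (df x). apply hd. lra.
  - specialize (hp c hc). nra.
Qed.

(** The first two terms of the series [2 (y + y^3/3 + y^5/5 + ...)]. The difference vanishes at 0
    and has derivative [2 y^4 / (1 - y^2)]. *)
Lemma ln_quotient_lower (y : R) :
  0 <= y < 1 -> 2 * y + 2 / 3 * y ^ 3 <= ln (1 + y) - ln (1 - y).
Proof.
  intros hy.
  enough (ln (1 + 0) - ln (1 - 0) - (2 * 0 + 2 / 3 * 0 ^ 3)
          <= ln (1 + y) - ln (1 - y) - (2 * y + 2 / 3 * y ^ 3)) as h.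
  { rewrite Rplus_0_r, Rminus_0_r in h. lra. }
  apply (le_of_derive_nonneg
           (fun y => ln (1 + y) - ln (1 - y) - (2 * y + 2 / 3 * y ^ 3))
           (fun y => 2 * y ^ 4 / ((1 - y) * (1 + y)))); [lra | | ].
  - intros x hx. auto_derive; [lra | field; lra].
  - intros x hx. apply Rdiv_le_0_compat; nra.
Qed.

(** In the same series all coefficients from [y^3] on are raised to [2/3], which leaves a geometric
    tail. *)
Lemma ln_quotient_upper (y : R) :
  0 <= y < 1 ->
  ln (1 + y) - ln (1 - y) <= 2 * y + 2 / 3 * (y ^ 3 / (1 - y ^ 2)).
Proof.
  intros hy.
  enough (2 * 0 + 2 / 3 * (0 ^ 3 / (1 - 0 ^ 2)) - (ln (1 + 0) - ln (1 - 0))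
          <= 2 * y + 2 / 3 * (y ^ 3 / (1 - y ^ 2)) - (ln (1 + y) - ln (1 - y))) as h.
  { rewrite Rplus_0_r, Rminus_0_r in h. lra. }
  apply (le_of_derive_nonneg
           (fun y => 2 * y + 2 / 3 * (y ^ 3 / (1 - y ^ 2)) - (ln (1 + y) - ln (1 - y)))
           (fun y => 4 / 3 * y ^ 4 / (1 - y ^ 2) ^ 2)); [lra | | ].
  - intros x hx. assert (1 - x ^ 2 <> 0) by nra.
    auto_derive; [repeat split; try lra; nra | field; repeat split; try lra; nra].
  - intros x hx. apply Rdiv_le_0_compat; [nra | apply pow_lt; nra].
Qed.

(* With [y = z / (2 + z)], [1 + z = (1 + y) / (1 - y)]. *)
Lemma ln_1p_lower (z : R) : 0 <= z -> 2 * z / (2 + z) <= ln (1 + z).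
Proof.
  intros hz. set (y := z / (2 + z)).
  assert (hy : 0 <= y < 1).
  { unfold y; split; [apply Rdiv_le_0_compat; lra | apply Rlt_div_l; lra]. }
  assert (h := ln_quotient_lower y hy).
  rewrite <- ln_div in h by lra.
  replace ((1 + y) / (1 - y)) with (1 + z) in h by (unfold y; field; lra).
  replace (2 * z / (2 + z)) with (2 * y) by (unfold y; field; lra).
  assert (0 <= y ^ 3) by (apply pow_le; lra). lra.
Qed.

(** * Wallis integrals and the central binomial coefficient *)

Definition wallis (n : nat) : R := RInt (fun x => sin x ^ n) 0 (PI / 2).

Lemma ex_RInt_sin_pow (n : nat) : ex_RInt (fun x => sin x ^ n) 0 (PI / 2).
Proof.
  apply (ex_RInt_continuous (V := R_CompleteNormedModule)). intros x _.
  apply (ex_derive_continuous (fun x => sin x ^ n)). auto_derive. exact I.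
Qed.

Lemma wallis_0 : wallis 0 = PI / 2.
Proof. unfold wallis. simpl. rewrite RInt_const. unfold scal; simpl; unfold mult; simpl. lra. Qed.

Lemma wallis_1 : wallis 1 = 1.
Proof.
  apply is_RInt_unique.
  apply (is_RInt_ext (fun x => sin x)); [intros; simpl; ring | ].
  replace 1 with (minus (- cos (PI / 2)) (- cos 0))
    by (rewrite cos_PI2, cos_0; unfold minus, plus, opp; simpl; ring).
  apply (is_RInt_derive (fun x => - cos x)).
  - intros x _. auto_derive; [exact I | ring].
  - intros x _. apply (ex_derive_continuous sin). auto_derive. exact I.
Qed.

(** The difference of the two integrands is the derivative of [cos x * sin x ^ (n + 1)], which
    vanishes at both endpoints. *)
Lemma wallis_rec (n : nat) : INR (n + 2) * wallis (n + 2) = INR (n + 1) * wallis n.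
Proof.
  assert (h : is_RInt (fun x => INR (n + 1) * sin x ^ n - INR (n + 2) * sin x ^ (n + 2))
                0 (PI / 2) 0).
  { replace 0 with (minus (cos (PI / 2) * sin (PI / 2) ^ (n + 1))
                          (cos 0 * sin 0 ^ (n + 1))) at 2
      by (rewrite cos_PI2, sin_0, pow_i by lia; unfold minus, plus, opp; simpl; ring).
    apply (is_RInt_derive (fun x => cos x * sin x ^ (n + 1))).
    - intros x _. auto_derive; [exact I | ].
      replace (Nat.pred (n + 1)) with n by lia.
      rewrite !pow_add, !plus_INR. simpl (INR 2). simpl (INR 1).
      assert (h := sin2_cos2 x). unfold Rsqr in h.
      assert (hc : cos x * cos x = 1 - sin x * sin x) by lra.
      transitivity (sin x ^ n * ((INR n + 1) * (cos x * cos x) - sin x * sin x));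
        [ring | rewrite hc; ring].
    - intros x _.
      apply (ex_derive_continuous
        (fun x => INR (n + 1) * sin x ^ n - INR (n + 2) * sin x ^ (n + 2))).
      auto_derive. repeat split. }
  assert (h2 := is_RInt_minus _ _ _ _ _ _
    (is_RInt_scal _ _ _ (INR (n + 1)) _ (RInt_correct _ _ _ (ex_RInt_sin_pow n)))
    (is_RInt_scal _ _ _ (INR (n + 2)) _ (RInt_correct _ _ _ (ex_RInt_sin_pow (n + 2))))).
  apply (is_RInt_unique (V := R_CompleteNormedModule)) in h. apply (is_RInt_unique (V := R_CompleteNormedModule)) in h2.
  unfold minus, plus, opp, scal in h2; simpl in h2; unfold mult in h2; simpl in h2.
  fold (wallis n) (wallis (n + 2)) in h2.
  unfold Rminus in h. rewrite h in h2. lra.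
Qed.

Lemma wallis_decr (n : nat) : wallis (n + 1) <= wallis n.
Proof.
  assert (hpi := PI_RGT_0).
  apply RInt_le; try apply ex_RInt_sin_pow; [lra | ].
  intros x hx. rewrite pow_add, pow_1.
  assert (0 <= sin x) by (apply sin_ge_0; lra).
  assert (hs := SIN_bound x).
  assert (0 <= sin x ^ n) by (apply pow_le; lra). nra.
Qed.

(** The central binomial coefficient divided by [4 ^ n]. *)
Definition central_ratio (n : nat) : R := INR (fact (2 * n)) / (4 ^ n * INR (fact n) ^ 2).

Lemma central_ratio_pos (n : nat) : 0 < central_ratio n.
Proof.
  apply Rdiv_lt_0_compat; [apply INR_fact_lt_0 | ].
  apply Rmult_lt_0_compat; apply pow_lt; [lra | apply INR_fact_lt_0].
Qed.

Lemma central_ratio_S (n : nat) :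
  central_ratio (S n) = central_ratio n * ((2 * INR n + 1) / (2 * INR n + 2)).
Proof.
  unfold central_ratio. replace (2 * S n)%nat with (S (S (2 * n))) by lia.
  rewrite !fact_simpl, !mult_INR, !S_INR, mult_INR. simpl (INR 2).
  assert (h := pos_INR n). assert (h1 := INR_fact_lt_0 n).
  assert (h2 : 0 < 4 ^ n) by (apply pow_lt; lra).
  simpl (4 ^ S n). field. lra.
Qed.

Lemma wallis_even (n : nat) : wallis (2 * n) = PI / 2 * central_ratio n.
Proof.
  induction n as [|n IH].
  - simpl (2 * 0)%nat. rewrite wallis_0. unfold central_ratio. simpl. field.
  - rewrite central_ratio_S. replace (2 * S n)%nat with (2 * n + 2)%nat by lia.
    assert (h := wallis_rec (2 * n)). rewrite IH in h.
    rewrite !plus_INR, mult_INR in h. simpl (INR 2) in h. simpl (INR 1) in h.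
    assert (hn := pos_INR n).
    apply (Rmult_eq_reg_l (2 * INR n + 2)); [ | lra].
    replace (1 + 1) with 2 in h by ring. rewrite h. field. lra.
Qed.

Lemma wallis_odd (n : nat) :
  wallis (2 * n + 1) * ((2 * INR n + 1) * central_ratio n) = 1.
Proof.
  induction n as [|n IH].
  - simpl (2 * 0 + 1)%nat. rewrite wallis_1. unfold central_ratio. simpl. field.
  - rewrite central_ratio_S. replace (2 * S n + 1)%nat with (2 * n + 1 + 2)%nat by lia.
    assert (h := wallis_rec (2 * n + 1)).
    rewrite !plus_INR, mult_INR in h. simpl (INR 2) in h. simpl (INR 1) in h.
    assert (hn := pos_INR n). rewrite S_INR.
    refine (eq_trans _ IH).
    replace (wallis (2 * n + 1 + 2)) with
      ((2 * INR n + 2) / (2 * INR n + 3) * wallis (2 * n + 1)).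
    + field. lra.
    + apply (Rmult_eq_reg_l ((1 + 1) * INR n + 1 + (1 + 1))); [ | lra].
      rewrite h. field. lra.
Qed.

(** The odd Wallis integral of index [2n + 1] lies between its even neighbours. The lower bound uses
    [(2n + 1)^2 / (4n + 4) = n + 1 / (4n + 4)] and drops the last fraction. *)
Lemma central_ratio_bounds (n : nat) :
  PI * INR n <= / central_ratio n ^ 2 <= PI * (INR n + 1 / 2).
Proof.
  assert (hq := central_ratio_pos n). set (q := central_ratio n) in *.
  assert (hn := pos_INR n). assert (hpi := PI_RGT_0).
  assert (hq2 : 0 < q ^ 2) by (apply pow_lt; lra).
  assert (he := wallis_even n). fold q in he.
  assert (ho : wallis (2 * n + 1) = / ((2 * INR n + 1) * q)).
  { assert (h := wallis_odd n). fold q in h.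
    apply (Rmult_eq_reg_r ((2 * INR n + 1) * q)); [ | nra].
    rewrite h. field. split; nra. }
  split.
  - assert (h := wallis_decr (2 * n + 1)).
    replace (2 * n + 1 + 1)%nat with (2 * S n)%nat in h by lia.
    rewrite wallis_even, central_ratio_S, ho in h. fold q in h.
    apply (Rmult_le_reg_r (q ^ 2)); [lra | ].
    rewrite Rinv_l by lra.
    apply (Rmult_le_compat_r ((2 * INR n + 1) * q)) in h; [ | nra].
    rewrite Rinv_l in h by nra.
    refine (Rle_trans _ _ _ _ h).
    replace (PI / 2 * (q * ((2 * INR n + 1) / (2 * INR n + 2))) * ((2 * INR n + 1) * q))
      with (PI * q ^ 2 * (INR n + / (4 * INR n + 4))) by (field; lra).
    assert (0 < / (4 * INR n + 4)) by (apply Rinv_0_lt_compat; lra).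
    assert (0 < PI * q ^ 2) by nra. nra.
  - assert (h := wallis_decr (2 * n)). rewrite he, ho in h.
    apply (Rmult_le_reg_r (q ^ 2)); [lra | ].
    rewrite Rinv_l by lra.
    apply (Rmult_le_compat_r ((2 * INR n + 1) * q)) in h; [ | nra].
    rewrite Rinv_l in h by nra. nra.
Qed.

(** * Stirling's formula with Robbins' error bounds *)

(** The logarithm of [n! e^n / n^(n + 1/2)] for [n >= 1], with limit [ln (2 * PI) / 2]. *)
Definition stirling_log (n : nat) : R :=
  ln (INR (fact n)) - (INR n + 1 / 2) * ln (INR n) + INR n.

(** With [y = 1 / (2N + 1)], [(N + 1) / N = (1 + y) / (1 - y)] and the leading term [(N + 1/2) * 2y]
    is 1. The upper estimate of the logarithm then gives exactly [1 / (12N) - 1 / (12(N + 1))]. *)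
Lemma stirling_log_step (n : nat) : (1 <= n)%nat ->
  1 / (12 * INR n + 1) - 1 / (12 * INR (S n) + 1)
    <= stirling_log n - stirling_log (S n) <= 1 / (12 * INR n) - 1 / (12 * INR (S n)).
Proof.
  intros hn. apply le_INR in hn. simpl (INR 1) in hn.
  assert (hf := INR_fact_lt_0 n).
  replace (stirling_log n - stirling_log (S n))
    with ((INR n + 1 / 2) * (ln (INR (S n)) - ln (INR n)) - 1).
  2:{ unfold stirling_log. rewrite fact_simpl, mult_INR, ln_mult, !S_INR;
        rewrite ?S_INR; lra. }
  rewrite S_INR. set (N := INR n) in *. set (y := / (2 * N + 1)).
  assert (hy : 0 <= y < 1).
  { unfold y. split; [apply Rlt_le, Rinv_0_lt_compat; lra | ].
    rewrite <- Rinv_1. apply Rinv_lt_contravar; lra. }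
  assert (e : ln (N + 1) - ln N = ln (1 + y) - ln (1 - y)).
  { rewrite <- !ln_div by lra. f_equal. unfold y. field. lra. }
  rewrite e. clear e.
  assert (l := ln_quotient_lower y hy). assert (u := ln_quotient_upper y hy).
  split.
  - apply Rle_trans with ((N + 1 / 2) * (2 * y + 2 / 3 * y ^ 3) - 1).
    + replace ((N + 1 / 2) * (2 * y + 2 / 3 * y ^ 3) - 1) with (1 / (3 * (2 * N + 1) ^ 2))
        by (unfold y; field; lra).
      replace (1 / (12 * N + 1) - 1 / (12 * (N + 1) + 1))
        with (12 / ((12 * N + 1) * (12 * N + 13))) by (field; lra).
      apply Rle_div_l; [nra | ].
      replace (1 / (3 * (2 * N + 1) ^ 2) * ((12 * N + 1) * (12 * N + 13)))
        with (((12 * N + 1) * (12 * N + 13)) / (3 * (2 * N + 1) ^ 2)) by (field; lra).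
      assert (0 < (2 * N + 1) ^ 2) by (apply pow_lt; lra).
      (* After cross-multiplication this is [24 N >= 23], so [N >= 1] suffices. *)
      apply (Rle_div_r 12 _ (3 * (2 * N + 1) ^ 2)); [lra | nra].
    + nra.
  - apply Rle_trans with ((N + 1 / 2) * (2 * y + 2 / 3 * (y ^ 3 / (1 - y ^ 2))) - 1);
      [nra | ].
    apply Req_le. unfold y. field. repeat split; nra.
Qed.

Lemma ln_le_sub_1 (x : R) : 0 < x -> ln x <= x - 1.
Proof. intros hx. assert (h := exp_ineq1_le (ln x)). rewrite exp_ln in h; lra. Qed.

Lemma exp_le_compat (x y : R) : x <= y -> exp x <= exp y.
Proof. intros [h | ->]; [apply Rlt_le, exp_increasing, h | lra]. Qed.

Lemma stirling_log_le (n m : nat) : (1 <= n)%nat -> (n <= m)%nat ->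
  1 / (12 * INR n + 1) - 1 / (12 * INR m + 1)
    <= stirling_log n - stirling_log m <= 1 / (12 * INR n) - 1 / (12 * INR m).
Proof.
  intros hn hm. induction hm as [|m hm IH]; [lra | ].
  assert (h := stirling_log_step m ltac:(lia)). lra.
Qed.

(** Identifies the constant: in this combination all factorials collect into [central_ratio m],
    which the Wallis bounds control. The combination has the same limit as [stirling_log] itself. *)
Lemma stirling_log_double (m : nat) : (1 <= m)%nat ->
  ln (2 * PI) / 2 <= 2 * stirling_log m - stirling_log (2 * m)
    <= ln (2 * PI) / 2 + 1 / (4 * INR m).
Proof.
  intros hm. apply le_INR in hm. simpl (INR 1) in hm.
  assert (hq := central_ratio_pos m). assert (hb := central_ratio_bounds m).
  assert (hpi := PI_RGT_0). assert (hf := INR_fact_lt_0 m).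
  assert (hf2 := INR_fact_lt_0 (2 * m)).
  assert (e : 2 * stirling_log m - stirling_log (2 * m)
              = (ln 2 + ln (/ central_ratio m ^ 2) - ln (INR m)) / 2).
  { rewrite ln_Rinv, ln_pow by (try apply pow_lt; lra).
    unfold central_ratio, stirling_log.
    assert (0 < 4 ^ m) by (apply pow_lt; lra).
    assert (0 < INR (fact m) ^ 2) by (apply pow_lt; lra).
    rewrite ln_div, ln_mult, !ln_pow by nra.
    rewrite mult_INR. simpl (INR 2). rewrite ln_mult by lra.
    replace 4 with (2 * 2) by ring. rewrite ln_mult by lra.
    replace (1 + 1) with 2 by ring. field. }
  rewrite e, ln_mult by lra. split.
  - assert (h : ln (PI * INR m) <= ln (/ central_ratio m ^ 2)) by (apply ln_le; nra).
    rewrite ln_mult in h by lra. lra.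
  - assert (h : ln (/ central_ratio m ^ 2) <= ln (PI * INR m * (1 + / (2 * INR m)))).
    { apply ln_le; [apply Rinv_0_lt_compat, pow_lt; lra | ].
      replace (PI * INR m * (1 + / (2 * INR m))) with (PI * (INR m + 1 / 2))
        by (field; lra). lra. }
    assert (hi : 0 < / (2 * INR m)) by (apply Rinv_0_lt_compat; lra).
    rewrite !ln_mult in h by nra.
    assert (h1 : ln (1 + / (2 * INR m)) <= / (2 * INR m)).
    { assert (h1 := ln_le_sub_1 (1 + / (2 * INR m))). lra. }
    replace (1 / (4 * INR m)) with (/ (2 * INR m) / 2) by (field; lra). lra.
Qed.

(** Subtracts [stirling_log m - stirling_log (2 * m)] from the previous combination. The constants
    are crude; only the rate [O(1/m)] matters below. *)
Lemma stirling_log_asymp (m : nat) : (1 <= m)%nat ->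
  ln (2 * PI) / 2 - 1 / (12 * INR m) <= stirling_log m <= ln (2 * PI) / 2 + 1 / (4 * INR m).
Proof.
  intros hm. assert (d := stirling_log_double m hm).
  assert (l := stirling_log_le m (2 * m) hm ltac:(lia)).
  apply le_INR in hm. simpl (INR 1) in hm.
  rewrite mult_INR in l. simpl (INR 2) in l.
  assert (1 / (12 * ((1 + 1) * INR m) + 1) <= 1 / (12 * INR m + 1)).
  { apply Rmult_le_compat_l, Rinv_le_contravar; lra. }
  assert (0 <= 1 / (12 * ((1 + 1) * INR m))) by (apply Rdiv_le_0_compat; lra).
  lra.
Qed.

(** Lets [m] tend to infinity by the Archimedean property, without a limit. *)
Lemma le_of_le_plus_inv (n : nat) (x c : R) :
  (forall m, (n <= m)%nat -> (1 <= m)%nat -> x <= c + 1 / INR m) -> x <= c.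
Proof.
  intros h. apply Rnot_lt_le. intros hc.
  destruct (nfloor_ex (1 / (x - c)) ltac:(apply Rdiv_le_0_compat; lra)) as [k hk].
  specialize (h (n + S k)%nat ltac:(lia) ltac:(lia)).
  assert (hs : 1 / (x - c) < INR (n + S k)).
  { rewrite plus_INR, S_INR. assert (h0 := pos_INR n). lra. }
  assert (h0 : 0 < 1 / (x - c)) by (apply Rdiv_lt_0_compat; lra).
  assert (h1 := Rinv_lt_contravar _ _ (Rmult_lt_0_compat _ _ h0 (Rlt_trans _ _ _ h0 hs)) hs).
  replace (/ (1 / (x - c))) with (x - c) in h1 by (field; lra). lra.
Qed.

(** The telescoped estimate from [n] to [m] and the crude asymptotics at [m] together err by at most
    [1/m], with [m] arbitrarily large. *)
Lemma stirling_log_bounds (n : nat) : (1 <= n)%nat ->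
  ln (2 * PI) / 2 + 1 / (12 * INR n + 1) <= stirling_log n
    <= ln (2 * PI) / 2 + 1 / (12 * INR n).
Proof.
  intros hn. split.
  - apply (le_of_le_plus_inv n). intros m hm h1.
    assert (l := stirling_log_le n m hn hm). assert (a := stirling_log_asymp m h1).
    apply le_INR in h1. simpl (INR 1) in h1.
    assert (1 / (12 * INR m + 1) <= 1 / (12 * INR m)).
    { apply Rmult_le_compat_l, Rinv_le_contravar; lra. }
    replace (1 / INR m) with (12 * (1 / (12 * INR m))) by (field; lra).
    assert (0 < 1 / (12 * INR m)) by (apply Rdiv_lt_0_compat; lra). lra.
  - apply (le_of_le_plus_inv n). intros m hm h1.
    assert (l := stirling_log_le n m hn hm). assert (a := stirling_log_asymp m h1).
    apply le_INR in h1. simpl (INR 1) in h1.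
    replace (1 / (4 * INR m)) with (3 * (1 / (12 * INR m))) in a by (field; lra).
    replace (1 / INR m) with (12 * (1 / (12 * INR m))) by (field; lra).
    assert (0 < 1 / (12 * INR m)) by (apply Rdiv_lt_0_compat; lra). lra.
Qed.

Lemma stirling_bounds (n : nat) : (1 <= n)%nat ->
  sqrt (2 * PI) * sqrt (INR n) * exp (1 / (12 * INR n + 1))
    <= INR (fact n) * exp (INR n) / INR n ^ n
    <= sqrt (2 * PI) * sqrt (INR n) * exp (1 / (12 * INR n)).
Proof.
  intros hn. assert (b := stirling_log_bounds n hn).
  apply le_INR in hn. simpl (INR 1) in hn.
  assert (hpi := PI_RGT_0). assert (hf := INR_fact_lt_0 n).
  assert (hs : forall x, 0 < x -> sqrt x = exp (ln x / 2)).
  { intros x hx. rewrite <- Rpower_sqrt by lra. unfold Rpower. f_equal. field. }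
  replace (INR (fact n) * exp (INR n) / INR n ^ n)
    with (exp (stirling_log n + ln (INR n) / 2)).
  2:{ rewrite <- Rpower_pow by lra. unfold stirling_log, Rpower, Rdiv.
      rewrite <- exp_Ropp.
      replace (_ + _) with (ln (INR (fact n)) + INR n + - (INR n * ln (INR n))) by field.
      rewrite !exp_plus, exp_ln; [reflexivity | lra]. }
  rewrite (hs (2 * PI)), (hs (INR n)), <- !exp_plus by lra.
  split; apply exp_le_compat; lra.
Qed.

(** * The logarithmic integral: existence of the principal value, and its derivative *)

Lemma continuous_inv_ln (t : R) : 0 < t -> t <> 1 -> continuous (fun t => / ln t) t.
Proof.
  intros h0 h1. apply (ex_derive_continuous (fun t => / ln t)).
  auto_derive. split; [exact h0 | split; [now apply ln_neq_0 | exact I]].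
Qed.

Lemma continuous_inv_ln_0 : continuous (fun t => / ln t) 0.
Proof.
  assert (hneg : forall t, t <= 0 -> ln t = 0).
  { intros t ht. unfold ln. case (Rlt_dec 0 t); intros h; [exfalso; lra | reflexivity]. }
  apply filterlim_locally. intros eps.
  assert (he := cond_pos eps).
  (* For [0 < t < exp (- / eps)], [ln t < - / eps]; for [t <= 0] the conventions make [/ ln t] equal
     to 0. *)
  exists (mkposreal (exp (- / eps)) (exp_pos _)). intros t ht.
  change (Rabs (t - 0) < exp (- / eps)) in ht. rewrite Rminus_0_r in ht.
  change (Rabs (/ ln t - / ln 0) < eps).
  rewrite (hneg 0) by lra. rewrite Rinv_0, Rminus_0_r.
  destruct (Rle_lt_dec t 0) as [h | h].
  - rewrite hneg, Rinv_0, Rabs_R0 by lra. exact he.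
  - rewrite Rabs_pos_eq in ht by lra.
    apply ln_increasing in ht; [ | exact h]. rewrite ln_exp in ht.
    assert (hi : 0 < / eps) by (apply Rinv_0_lt_compat; lra).
    rewrite Rabs_inv, Rabs_left by lra.
    rewrite <- (Rinv_inv eps). apply Rinv_lt_contravar; nra.
Qed.

Lemma ex_RInt_inv_ln_below_1 (b : R) : 0 <= b < 1 -> ex_RInt (fun t => / ln t) 0 b.
Proof.
  intros hb. apply (ex_RInt_continuous (V := R_CompleteNormedModule)).
  intros z. rewrite Rmin_left, Rmax_right by lra. intros [[hz | <-] hz'].
  - apply continuous_inv_ln; lra.
  - apply continuous_inv_ln_0.
Qed.

Lemma ex_RInt_inv_ln_above_1 (a b : R) : 1 < a -> 1 < b -> ex_RInt (fun t => / ln t) a b.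
Proof.
  intros ha hb. apply (ex_RInt_continuous (V := R_CompleteNormedModule)).
  intros z hz. assert (1 < Rmin a b) by (apply Rmin_glb_lt; lra).
  apply continuous_inv_ln; lra.
Qed.

Lemma is_derive_li_truncated (x d : R) : 1 < x -> 0 < d < 1 ->
  is_derive (li_truncated x) d (- / ln (1 - d) - / ln (1 + d)).
Proof.
  intros hx hd. unfold li_truncated.
  assert (l : is_derive (fun d => RInt (fun t => / ln t) 0 (1 - d)) d (-1 * / ln (1 - d))).
  { apply (is_derive_comp (fun b => RInt (fun t => / ln t) 0 b) (fun d => 1 - d)).
    - apply (is_derive_RInt (V := R_NormedModule) (fun t => / ln t)
               (fun b => RInt (fun t => / ln t) 0 b) 0).
      + apply (locally_interval _ _ 0 1); simpl; try lra. intros y hy1 hy2.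
        apply (RInt_correct (V := R_CompleteNormedModule)), ex_RInt_inv_ln_below_1. lra.
      + apply continuous_inv_ln; lra.
    - auto_derive; [exact I | ring]. }
  assert (r : is_derive (fun d => RInt (fun t => / ln t) (1 + d) x) d (1 * - / ln (1 + d))).
  { apply (is_derive_comp (fun a => RInt (fun t => / ln t) a x) (fun d => 1 + d)).
    - apply (is_derive_RInt' (V := R_NormedModule) (fun t => / ln t)
               (fun a => RInt (fun t => / ln t) a x) (1 + d) x).
      + apply (locally_interval _ _ 1 p_infty); simpl; try lra; try exact I. intros y hy1 hy2.
        apply (RInt_correct (V := R_CompleteNormedModule)), ex_RInt_inv_ln_above_1; lra.
      + apply continuous_inv_ln; lra.
    - auto_derive; [exact I | ring]. }
  replace (- / ln (1 - d) - / ln (1 + d)) with (-1 * / ln (1 - d) + 1 * - / ln (1 + d))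
    by ring.
  apply (is_derive_plus (V := R_NormedModule) _ _ _ _ _ l r).
Qed.

(* The poles of [/ ln] on the two sides of 1 cancel up to a bounded term. *)
Lemma inv_ln_symmetric_bounds (d : R) : 0 < d < 1 ->
  0 <= / ln (1 - d) + / ln (1 + d) <= 2.
Proof.
  intros hd.
  assert (hi : forall a b c, 0 < a -> a <= b -> b <= c -> / c <= / b <= / a).
  { intros a b c h1 h2 h3. split; apply Rinv_le_contravar; lra. }
  (* Applied to [1 - d], [1 + d] and their reciprocals, [ln x <= x - 1] encloses both logarithms.
     Inverting, [/ ln (1 + d)] lies in [[1/d, 1/d + 1]] and [- / ln (1 - d)] in [[1/d - 1, 1/d]]. *)
  assert (h1 := ln_le_sub_1 (1 - d) ltac:(lra)).
  assert (h2 := ln_le_sub_1 (1 + d) ltac:(lra)).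
  assert (h3 := ln_le_sub_1 (/ (1 - d)) ltac:(apply Rinv_0_lt_compat; lra)).
  assert (h4 := ln_le_sub_1 (/ (1 + d)) ltac:(apply Rinv_0_lt_compat; lra)).
  rewrite ln_Rinv in h3, h4 by lra.
  replace (/ (1 - d) - 1) with (d / (1 - d)) in h3 by (field; lra).
  replace (/ (1 + d) - 1) with (- (d / (1 + d))) in h4 by (field; lra).
  assert (p : 0 < d / (1 + d)) by (apply Rdiv_lt_0_compat; lra).
  destruct (hi (d / (1 + d)) (ln (1 + d)) d) as [a1 a2]; try lra.
  destruct (hi d (- ln (1 - d)) (d / (1 - d))) as [b1 b2]; try lra.
  replace (/ (d / (1 + d))) with (/ d + 1) in a2 by (field; lra).
  replace (/ (d / (1 - d))) with (/ d - 1) in b1 by (field; lra).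
  rewrite Rinv_opp in b1, b2. lra.
Qed.

Lemma li_truncated_lipschitz (x u v : R) : 1 < x -> 0 < u < 1 -> 0 < v < 1 ->
  Rabs (li_truncated x v - li_truncated x u) <= 2 * Rabs (v - u).
Proof.
  intros hx hu hv.
  destruct (MVT_gen (li_truncated x) u v
              (fun d => - / ln (1 - d) - / ln (1 + d))) as [c [hc e]].
  - intros d hd. apply is_derive_li_truncated; [exact hx | ].
    assert (0 < Rmin u v) by (apply Rmin_glb_lt; lra).
    assert (Rmax u v < 1) by (apply Rmax_lub_lt; lra). lra.
  - intros d hd. apply derivable_continuous_pt, ex_derive_Reals_0.
    eexists. apply is_derive_li_truncated; [exact hx | ].
    assert (0 < Rmin u v) by (apply Rmin_glb_lt; lra).
    assert (Rmax u v < 1) by (apply Rmax_lub_lt; lra). lra.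
  - rewrite e, Rabs_mult. apply Rmult_le_compat_r; [apply Rabs_pos | ].
    assert (0 < Rmin u v) by (apply Rmin_glb_lt; lra).
    assert (Rmax u v < 1) by (apply Rmax_lub_lt; lra).
    assert (b := inv_ln_symmetric_bounds c ltac:(lra)).
    apply Rabs_le. lra.
Qed.

(** The Lipschitz bound makes the truncated integrals Cauchy as [d] tends to 0, so a limit exists;
    [iota] returns it because limits are unique. *)
Lemma li_correct (x : R) : 1 < x -> filterlim (li_truncated x) (at_right 0) (locally (li x)).
Proof.
  intros hx.
  assert (hex : exists l : R, filterlim (li_truncated x) (at_right 0) (locally l)).
  { apply (filterlim_locally_cauchy (U := R_CompleteSpace)). intros eps.
    assert (he := cond_pos eps).
    exists (fun d => 0 < d < Rmin 1 (eps / 2)). split.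
    - assert (hm : 0 < Rmin 1 (eps / 2)) by (apply Rmin_glb_lt; lra).
      exists (mkposreal _ hm). intros d hd h0.
      change (Rabs (d - 0) < Rmin 1 (eps / 2)) in hd.
      rewrite Rabs_pos_eq in hd by lra. lra.
    - intros u v hu hv.
      assert (h1 := Rmin_l 1 (eps / 2)). assert (h2 := Rmin_r 1 (eps / 2)).
      change (Rabs (li_truncated x v - li_truncated x u) < eps).
      apply Rle_lt_trans with (2 * Rabs (v - u)).
      + apply li_truncated_lipschitz; lra.
      + assert (Rabs (v - u) < eps / 2) by (apply Rabs_def1; lra). lra. }
  destruct hex as [l hl]. unfold li.
  replace (iota _) with l; [exact hl | symmetry].
  exact (iota_filterlim_locally (V := R_CompleteNormedModule) (li_truncated x) l hl).
Qed.

Lemma li_Chasles (a b : R) : 1 < a -> 1 < b -> li b = li a + RInt (fun t => / ln t) a b.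
Proof.
  intros ha hb.
  apply (filterlim_locally_unique (V := R_NormedModule) (F := at_right 0) (li_truncated b)).
  - apply li_correct, hb.
  - apply filterlim_ext_loc
      with (fun d => plus (li_truncated a d) (RInt (fun t => / ln t) a b)).
    (* Any radius works: the integrals are oriented, so [1 + d] may exceed [a] or [b]. *)
    + exists (mkposreal 1 Rlt_0_1). intros d _ hd.
      unfold li_truncated. simpl. unfold plus; simpl.
      rewrite Rplus_assoc. f_equal.
      apply (RInt_Chasles (V := R_CompleteNormedModule)); apply ex_RInt_inv_ln_above_1; lra.
    + eapply filterlim_comp_2; [apply li_correct, ha | apply filterlim_const | ].
      apply (filterlim_plus (V := R_NormedModule)).
Qed.

Lemma is_derive_li (x : R) : 1 < x -> is_derive li x (/ ln x).
Proof.
  intros hx.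
  apply is_derive_ext_loc with (fun b => li x + RInt (fun t => / ln t) x b).
  - apply (locally_interval _ _ 1 p_infty); simpl; try lra; try exact I. intros y hy1 hy2.
    symmetry. apply li_Chasles; lra.
  - replace (/ ln x) with (plus 0 (/ ln x)) by (unfold plus; simpl; ring).
    apply (is_derive_plus (V := R_NormedModule)).
    + apply (is_derive_const (V := R_NormedModule)).
    + apply (is_derive_RInt (V := R_NormedModule) (fun t => / ln t) _ x).
      * apply (locally_interval _ _ 1 p_infty); simpl; try lra; try exact I. intros y hy1 hy2.
        apply (RInt_correct (V := R_CompleteNormedModule)), ex_RInt_inv_ln_above_1; lra.
      * apply continuous_inv_ln; lra.
Qed.

(** * Explicit primitives of the two comparison integrands *)

(* The right side is what the lower bound on the increments needs; the
   difference is [O(t^5)] at 0 and its derivative is rational. *)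
Lemma ln_1p_upper (t : R) : 0 <= t -> (1 + t) ^ 2 <= 2 ->
  ln (1 + t) <=
    (32 * t + 96 * t ^ 2 + 368 / 3 * t ^ 3 + 268 / 3 * t ^ 4 + 194 / 5 * t ^ 5
     + 122 / 15 * t ^ 6 + 3 / 2 * t ^ 7 + 1 / 2 * t ^ 8)
    / (4 * (1 + t) ^ 2 * ((1 + t) ^ 2 + 1) * ((1 + t) ^ 2 + 3)).
Proof.
  intros h0 h2.
  set (F := fun t => (32 * t + 96 * t ^ 2 + 368 / 3 * t ^ 3 + 268 / 3 * t ^ 4
     + 194 / 5 * t ^ 5 + 122 / 15 * t ^ 6 + 3 / 2 * t ^ 7 + 1 / 2 * t ^ 8)
    / (4 * (1 + t) ^ 2 * ((1 + t) ^ 2 + 1) * ((1 + t) ^ 2 + 3))).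
  enough (F 0 - ln (1 + 0) <= F t - ln (1 + t)) as h.
  { rewrite Rplus_0_r, ln_1 in h. unfold F in h.
    match type of h with (?z / _ - 0 <= _) => replace z with 0 in h by ring end.
    unfold Rdiv at 1 in h. rewrite Rmult_0_l in h. lra. }
  assert (hq : forall x, 0 <= x ->
    0 < 4 * (1 + x) ^ 2 * ((1 + x) ^ 2 + 1) * ((1 + x) ^ 2 + 3)).
  { intros x hx. assert (0 < (1 + x) ^ 2) by (apply pow_lt; lra).
    repeat apply Rmult_lt_0_compat; lra. }
  apply (le_of_derive_nonneg (fun t => F t - ln (1 + t))
    (fun t => t ^ 4 * (64 + 64 * t - 864 / 5 * t ^ 2 - 304 / 5 * t ^ 3 + 4092 / 5 * t ^ 4
       + 1588 * t ^ 5 + 7238 / 5 * t ^ 6 + 774 * t ^ 7 + 250 * t ^ 8 + 46 * t ^ 9 + 4 * t ^ 10)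
       / ((4 * (1 + t) ^ 2 * ((1 + t) ^ 2 + 1) * ((1 + t) ^ 2 + 3)) ^ 2 * (1 + t))));
    [exact h0 | | ].
  - intros x hx. assert (h := hq x ltac:(lra)). unfold F.
    auto_derive; [split; [lra | split; [lra | exact I]] | ].
    assert (0 < (1 + x) ^ 2) by (apply pow_lt; lra).
    field. repeat split; try lra; nra.
  - intros x hx. assert (h := hq x ltac:(lra)).
    (* This follows from [(1 + t)^2 <= 2]; it lets [64 + 64 x] absorb the two negative terms, in
       [x^2] and [x^3]. *)
    assert (x <= 1 / 2) by nra.
    apply Rdiv_le_0_compat.
    + apply Rmult_le_pos; [apply pow_le; lra | ].
      assert (p : forall k, 0 <= x ^ k) by (intros k; apply pow_le; lra).
      assert (p4 := p 4%nat). assert (p5 := p 5%nat). assert (p6 := p 6%nat).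
      assert (p7 := p 7%nat). assert (p8 := p 8%nat). assert (p9 := p 9%nat).
      assert (p10 := p 10%nat).
      assert (x ^ 2 <= 1 / 2 * x) by (simpl; nra).
      assert (x ^ 3 <= 1 / 4 * x) by (simpl; nra). lra.
    + apply Rmult_lt_0_compat; [apply pow_lt | ]; lra.
Qed.

(** Integrates the weight that remains when [exp g] is replaced by 1; [Y] stands for [1 + 1/n]. *)
Definition quadratic_primitive (Y w : R) : R := - w ^ 3 / 3 + (1 + Y) * w + Y / w.

Lemma is_derive_quadratic_primitive (Y w : R) : 0 < w ->
  is_derive (quadratic_primitive Y) w ((w ^ 2 - 1) * (Y - w ^ 2) / w ^ 2).
Proof. intros hw. unfold quadratic_primitive. auto_derive; [lra | field; lra]. Qed.

(** Integrates the weight times [(1 + g + 1/(8n)) / n], written in [Y] by means of [1/n = Y - 1].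
    The last line comes from integrating the weight times [ln w] by parts. *)
Definition log_primitive (Y w : R) : R :=
  ((Y - 1) + (Y - 1) ^ 2 / 8 - 1) * quadratic_primitive Y w
  + (- w ^ 5 / 5 + (1 + Y) * w ^ 3 / 3 - Y * w)
  - (Y + 1) * (quadratic_primitive Y w * ln w - (- w ^ 3 / 9 + (1 + Y) * w - Y / w)).

Lemma is_derive_log_primitive (Y w : R) : 0 < w ->
  is_derive (log_primitive Y) w
    ((w ^ 2 - 1) * (Y - w ^ 2) / w ^ 2
     * ((Y - 1) + (Y - 1) ^ 2 / 8 + (w ^ 2 - 1) - (Y + 1) * ln w)).
Proof.
  intros hw. unfold log_primitive, quadratic_primitive.
  auto_derive; [repeat split; lra | field; lra].
Qed.

(** The left side is [2/3 (y - 1)^3], and the gap is exactly [(y - 1)^5 / (6y)]. The factor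
    [1 - / y] is kept because it later telescopes. *)
Lemma quadratic_primitive_increment (y : R) : 1 <= y ->
  quadratic_primitive (y ^ 2) y - quadratic_primitive (y ^ 2) 1
    <= (y ^ 2 - 1) ^ 2 * (1 - / y) / 6.
Proof.
  intros hy. unfold quadratic_primitive.
  enough (0 <= (y - 1) ^ 5 / (6 * y)) as h.
  { match goal with |- ?l <= ?r =>
      replace r with (l + (y - 1) ^ 5 / (6 * y)) by (field; lra) end. lra. }
  apply Rdiv_le_0_compat; [apply pow_le | ]; lra.
Qed.

Lemma log_primitive_increment (y : R) : 1 <= y -> y ^ 2 <= 2 ->
  (y ^ 2 - 1) ^ 3 * (1 - / y) / 6
    <= log_primitive (y ^ 2) y - log_primitive (y ^ 2) 1.
Proof.
  intros hy hy2.
  assert (h := ln_1p_upper (y - 1) ltac:(lra)).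
  replace (1 + (y - 1)) with y in h by ring. specialize (h hy2).
  set (r := _ / _) in h.
  unfold log_primitive, quadratic_primitive. rewrite ln_1.
  (* [- q] is the coefficient of [ln y] in the increment, so solving the claim for [ln y] gives
     [ln y <= r]. *)
  set (q := 2 / 3 * y * (y ^ 2 + 1) * (y ^ 2 + 3)).
  assert (hq : 0 < q).
  { assert (0 < y ^ 2) by (apply pow_lt; lra).
    unfold q. repeat apply Rmult_lt_0_compat; lra. }
  enough (0 <= q * (r - ln y)) as hp.
  { match goal with |- ?a <= ?b => replace b with (a + q * (r - ln y)) end; [lra | ].
    unfold q, r. field. repeat split; nra. }
  apply Rmult_le_pos; lra.
Qed.

(** * The error increments as increments of an antiderivative *)

(** The divergent asymptotic series of [li (exp t)], cut after [m + 1] terms. *)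
Definition stieltjes_sum (m : nat) (t : R) : R :=
  exp t / t * sum_f_R0 (fun k => INR (fact k) / t ^ k) m.

Lemma stieltjes_sum_S (m : nat) (t : R) : 0 < t ->
  stieltjes_sum (S m) t
  = stieltjes_sum m t + INR (fact (S m)) * (exp t / t ^ (m + 2)).
Proof.
  intros ht. unfold stieltjes_sum. rewrite tech5, pow_add.
  assert (0 < t ^ m) by (apply pow_lt; lra). simpl pow. field. lra.
Qed.

(** The derivatives telescope: that of [k! e^t / t^(k+1)] is itself minus the next term of the
    series. *)
Lemma is_derive_stieltjes_sum (m : nat) (t : R) : 0 < t ->
  is_derive (stieltjes_sum m) t (exp t / t - INR (fact (S m)) * (exp t / t ^ (m + 2))).
Proof.
  intros ht. induction m as [|m IH].
  - apply is_derive_ext with (fun t => exp t / t).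
    { intros x. unfold stieltjes_sum. simpl. unfold Rdiv. ring_simplify. rewrite Rinv_1. ring. }
    auto_derive; [lra | simpl; field; lra].
  - apply is_derive_ext_loc
      with (fun t => stieltjes_sum m t + INR (fact (S m)) * (exp t / t ^ (m + 2))).
    { apply (locally_interval _ _ 0 p_infty); simpl; try lra; try exact I. intros x hx _.
      symmetry. now apply stieltjes_sum_S. }
    assert (hp : 0 < t ^ m) by (apply pow_lt; lra).
    replace (exp t / t - INR (fact (S (S m))) * (exp t / t ^ (S m + 2))) with
      (plus (exp t / t - INR (fact (S m)) * (exp t / t ^ (m + 2)))
         (INR (fact (S m)) * (exp t / t ^ (m + 2) - INR (m + 2) * (exp t / t ^ (m + 3))))).
    + apply (is_derive_plus (V := R_NormedModule) _ _ _ _ _ IH).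
      generalize (INR (fact (S m))). intros F.
      auto_derive; [apply pow_nonzero; lra | ].
      replace (Nat.pred (m + 2)) with (m + 1)%nat by lia.
      rewrite !pow_add. simpl pow. field. lra.
    + rewrite (fact_simpl (S m)), mult_INR.
      replace (S (S m)) with (m + 2)%nat by lia. replace (S m + 2)%nat with (m + 3)%nat by lia.
      unfold plus; simpl. ring.
Qed.

(* An antiderivative whose increment over [[n, n + 1]], [n = m + 1], is
   [eps_n - eps_(n + 1)]: the sum absorbs the change from [n] to [n + 1] terms
   through the last summand, which vanishes at [n]. *)
Definition error_primitive (m : nat) (t : R) : R :=
  li (exp t) - stieltjes_sum m t
  - INR (fact (S m)) * ((t - INR (S m)) * (exp t / t ^ (m + 2))).

(** The contributions [exp t / t] of [li] and of the sum cancel. What remains is [(S m)!] times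
    [exp t / t^(m+2)] times [(t - N) ((N + 1) / t - 1)], where [N = m + 1]. *)
Lemma is_derive_error_primitive (m : nat) (t : R) : 0 < t ->
  is_derive (error_primitive m) t
    (INR (fact (S m)) * ((t - INR (S m)) * (INR (S m) + 1 - t) * (exp t / t ^ (m + 3)))).
Proof.
  intros ht. unfold error_primitive.
  assert (hp : 0 < t ^ m) by (apply pow_lt; lra).
  assert (hexp : 1 < exp t) by (rewrite <- exp_0; apply exp_increasing, ht).
  assert (hl := is_derive_comp (V := R_NormedModule) li exp t _ _
                  (is_derive_li _ hexp) (is_derive_exp t)).
  rewrite ln_exp in hl.
  assert (hr : is_derive
    (fun t => INR (fact (S m)) * ((t - INR (S m)) * (exp t / t ^ (m + 2)))) t
    (INR (fact (S m)) * (exp t / t ^ (m + 2) + (t - INR (S m)) *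
       (exp t / t ^ (m + 2) - INR (m + 2) * (exp t / t ^ (m + 3)))))).
  { generalize (INR (fact (S m))) (INR (S m)). intros F N.
    auto_derive; [apply pow_nonzero; lra | ].
    replace (Nat.pred (m + 2)) with (m + 1)%nat by lia.
    rewrite !pow_add. simpl pow. field. lra. }
  assert (h := is_derive_minus (V := R_NormedModule) _ _ _ _ _
                 (is_derive_minus (V := R_NormedModule) _ _ _ _ _ hl
                    (is_derive_stieltjes_sum m t ht)) hr).
  match type of h with is_derive _ _ ?d =>
    match goal with |- is_derive _ _ ?d' => replace d' with d; [exact h | ] end end.
  replace (INR (m + 2)) with (INR (S m) + 1) by (rewrite plus_INR, S_INR; simpl; ring).
  generalize (INR (fact (S m))) (INR (S m)). intros F N.
  unfold minus, plus, opp, scal; simpl; unfold mult; simpl.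
  rewrite !pow_add. simpl. field. lra.
Qed.

(** The logarithm is an integer here, so the correction term of [li_star] has the factor 0. *)
Lemma stieltjes_error_seq_eq (m : nat) :
  stieltjes_error_seq (S m) = stieltjes_sum m (INR (S m)) - li (exp (INR (S m))).
Proof.
  unfold stieltjes_error_seq, stieltjes_error, li_star, stieltjes_sum, n_star.
  rewrite ln_exp, Int_part_INR, Nat2Z.id, Nat.sub_succ, Nat.sub_0_r.
  unfold Rdiv. ring.
Qed.

Lemma stieltjes_error_step (m : nat) :
  stieltjes_error_seq (S m) - stieltjes_error_seq (S (S m))
  = error_primitive m (INR (S m) + 1) - error_primitive m (INR (S m)).
Proof.
  assert (h := pos_INR m).
  rewrite !stieltjes_error_seq_eq, stieltjes_sum_S by (rewrite !S_INR; lra).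
  unfold error_primitive. rewrite <- (S_INR (S m)).
  rewrite (S_INR (S m)). ring.
Qed.

(* The integrand after the substitution [t = N w ^ 2]. *)
Lemma is_derive_error_primitive_sqr (m : nat) (w : R) : 0 < w ->
  let N := INR (S m) in
  is_derive (fun w => error_primitive m (N * w ^ 2)) w
    (2 * N * (INR (fact (S m)) * exp N / N ^ S m)
     * ((w ^ 2 - 1) * ((1 + / N) - w ^ 2) / w ^ 2)
     * exp (N * (w ^ 2 - 1) - (2 * N + 1) * ln w)).
Proof.
  intros hw N.
  assert (hN : 0 < N) by (apply lt_0_INR; lia).
  assert (hw2 : 0 < w ^ 2) by (apply pow_lt, hw).
  assert (h := is_derive_comp (V := R_NormedModule) (error_primitive m)
    (fun w => N * w ^ 2) w _ (2 * N * w)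
    (is_derive_error_primitive m _ (Rmult_lt_0_compat _ _ hN hw2))
    ltac:(auto_derive; [exact I | ring])).
  match type of h with is_derive _ _ ?d =>
    match goal with |- is_derive _ _ ?d' => replace d' with d; [exact h | ] end end.
  match goal with |- scal ?a ?b = _ => change (scal a b) with (a * b) end.
  fold N. generalize (INR (fact (S m))). intros F.
  replace (exp (N * (w ^ 2 - 1) - (2 * N + 1) * ln w))
    with (exp (N * w ^ 2) * / exp N * / (w ^ m * w ^ m * w ^ 3)).
  - assert (0 < exp N) by apply exp_pos. assert (0 < N ^ m) by (apply pow_lt, hN).
    assert (0 < w ^ m) by (apply pow_lt, hw).
    rewrite Rpow_mult_distr, !pow_add, <- pow_mult. replace (2 * m)%nat with (m + m)%nat by lia.
    rewrite pow_add. simpl. field. repeat split; lra.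
  (* As [N = m + 1], the exponent [2N + 1] is the natural number [2m + 3]. *)
  - replace (w ^ m * w ^ m * w ^ 3) with (Rpower w (2 * N + 1)).
    + unfold Rpower. rewrite <- !exp_Ropp, <- !exp_plus. f_equal. ring.
    + replace (2 * N + 1) with (INR (m + m + 3)).
      * rewrite Rpower_pow, !pow_add; [reflexivity | exact hw].
      * unfold N. rewrite !plus_INR, (S_INR m). simpl. ring.
Qed.

(** * Bounds for one step, and their summation *)

(** Each bound says that a difference of two primitives has a nonnegative derivative on [[1, y]], so
    no integral in [w] is formed. *)
Lemma error_primitive_increment_bounds (m : nat) :
  let N := INR (S m) in
  let C := INR (fact (S m)) * exp N / N ^ S m in
  let D := error_primitive m (N + 1) - error_primitive m N in
  let y := sqrt (1 + / N) in
  C * exp (- (1 / (8 * N))) * (1 - / y) / (3 * N) <= D <= C * (1 - / y) / (3 * N).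
Proof.
  intros N C D y.
  assert (hN : 1 <= N) by (apply (le_INR 1); lia).
  assert (hi : 0 < / N <= 1).
  { split; [apply Rinv_0_lt_compat; lra | ]. rewrite <- Rinv_1. apply Rinv_le_contravar; lra. }
  assert (hy2 : y ^ 2 = 1 + / N) by (apply pow2_sqrt; lra).
  assert (hy : 1 <= y) by (rewrite <- sqrt_1; apply sqrt_le_1; lra).
  assert (hX : (y ^ 2 - 1) * N = 1) by (rewrite hy2; field; lra).
  assert (hC : 0 < C).
  { apply Rdiv_lt_0_compat; [apply Rmult_lt_0_compat | apply pow_lt; lra];
      [apply INR_fact_lt_0 | apply exp_pos]. }
  assert (hNC : 0 < 2 * N * C) by (apply Rmult_lt_0_compat; lra).
  assert (hD : D = error_primitive m (N * y ^ 2) - error_primitive m (N * 1 ^ 2)).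
  { unfold D. f_equal; [ | f_equal]; f_equal; [rewrite hy2; field; lra | ring]. }
  assert (hk : forall w, 1 <= w <= y ->
    0 <= 2 * N * C * ((w ^ 2 - 1) * (y ^ 2 - w ^ 2) / w ^ 2)).
  { intros w hw. apply Rmult_le_pos; [apply Rlt_le, hNC | ].
    apply Rdiv_le_0_compat; [ | apply pow_lt; lra].
    assert (1 <= w ^ 2) by (apply pow_R1_Rle; lra).
    assert (w ^ 2 <= y ^ 2) by (apply pow_incr; lra). apply Rmult_le_pos; lra. }
  assert (hE := fun w hw => is_derive_error_primitive_sqr m w hw).
  cbv zeta in hE. fold N in hE. fold C in hE. rewrite <- hy2 in hE.
  split.
  (* The trailing factor [N] undoes the division by [N] built into [log_primitive]. *)
  - set (c := 2 * N * C * exp (- (1 / (8 * N))) * N).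
    assert (hc : 0 < c).
    { apply Rmult_lt_0_compat; [apply Rmult_lt_0_compat; [exact hNC | apply exp_pos] | lra]. }
    assert (h : error_primitive m (N * 1 ^ 2) - c * log_primitive (y ^ 2) 1
                <= error_primitive m (N * y ^ 2) - c * log_primitive (y ^ 2) y).
    { eapply (le_of_derive_nonneg
        (fun w => error_primitive m (N * w ^ 2) - c * log_primitive (y ^ 2) w)).
      - exact hy.
      - intros w hw. apply (is_derive_minus (V := R_NormedModule)).
        + apply hE. lra.
        + apply (is_derive_scal (log_primitive (y ^ 2))), is_derive_log_primitive. lra.
      - intros w hw. cbv beta. match goal with |- 0 <= minus ?a ?b => change (0 <= a - b) end.
        specialize (hk w hw).
        set (k := (w ^ 2 - 1) * (y ^ 2 - w ^ 2) / w ^ 2) in *.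
        set (g := N * (w ^ 2 - 1) - (2 * N + 1) * ln w).
        (* Tangent of [exp] at [- 1/(8N)], which approximates the value of [g] at its minimum
           [w^2 = 1 + 1/(2N)]. *)
        assert (he : exp (- (1 / (8 * N))) * (1 + (g + 1 / (8 * N))) <= exp g).
        { replace g with (- (1 / (8 * N)) + (g + 1 / (8 * N))) at 2 by ring.
          rewrite exp_plus. apply Rmult_le_compat_l; [apply Rlt_le, exp_pos | ].
          apply exp_ineq1_le. }
        assert (hg : 1 + (g + 1 / (8 * N))
          = N * (y ^ 2 - 1 + (y ^ 2 - 1) ^ 2 / 8 + (w ^ 2 - 1) - (y ^ 2 + 1) * ln w)).
        { unfold g. rewrite hy2. field. lra. }
        rewrite hg in he.
        apply (Rmult_le_compat_l _ _ _ hk) in he.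
        match goal with |- 0 <= ?a => match type of he with ?u <= ?v =>
          replace a with (v - u) by (unfold c; ring) end end.
        lra. }
    assert (hl := log_primitive_increment y hy ltac:(lra)).
    apply (Rmult_le_compat_l c) in hl; [ | lra].
    replace (c * ((y ^ 2 - 1) ^ 3 * (1 - / y) / 6))
      with (C * exp (- (1 / (8 * N))) * (1 - / y) / (3 * N)) in hl; [lra | ].
    unfold c. rewrite hy2. field. lra.
  - assert (h : 2 * N * C * quadratic_primitive (y ^ 2) 1 - error_primitive m (N * 1 ^ 2)
                <= 2 * N * C * quadratic_primitive (y ^ 2) y - error_primitive m (N * y ^ 2)).
    { eapply (le_of_derive_nonneg
        (fun w => 2 * N * C * quadratic_primitive (y ^ 2) w - error_primitive m (N * w ^ 2))).
      - exact hy.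
      - intros w hw. apply (is_derive_minus (V := R_NormedModule)).
        + apply (is_derive_scal (quadratic_primitive (y ^ 2))), is_derive_quadratic_primitive.
          lra.
        + apply hE. lra.
      - intros w hw. cbv beta. match goal with |- 0 <= minus ?a ?b => change (0 <= a - b) end.
        specialize (hk w hw).
        set (k := (w ^ 2 - 1) * (y ^ 2 - w ^ 2) / w ^ 2) in *.
        assert (hz : 0 <= w ^ 2 - 1) by nra.
        assert (hln := ln_1p_lower (w ^ 2 - 1) hz).
        replace (1 + (w ^ 2 - 1)) with (w ^ 2) in hln by ring.
        rewrite ln_pow in hln by lra. simpl (INR 2) in hln.
        (* With [z = w^2 - 1], [ln w >= z / (2 + z)] reduces the claim to [N z^2 <= z], which holds
           because [w <= y] gives [N z <= 1]. *)
        assert (hg : N * (w ^ 2 - 1) - (2 * N + 1) * ln w <= 0).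
        { assert (hwy : w ^ 2 <= y ^ 2) by (apply pow_incr; lra).
          assert (N * (w ^ 2 - 1) <= (2 * N + 1) * ((w ^ 2 - 1) / (2 + (w ^ 2 - 1)))); [ | ].
          - apply Rle_trans with ((2 * N + 1) * (w ^ 2 - 1) / (2 + (w ^ 2 - 1)));
              [ | apply Req_le; field; lra].
            assert (N * (w ^ 2 - 1) <= 1) by nra.
            assert (0 <= (w ^ 2 - 1) * (1 - N * (w ^ 2 - 1))) by (apply Rmult_le_pos; lra).
            refine (proj1 (Rle_div_r _ _ _ _) _); [lra | nra].
          - replace (2 * (w ^ 2 - 1) / (2 + (w ^ 2 - 1)))
              with (2 * ((w ^ 2 - 1) / (2 + (w ^ 2 - 1)))) in hln by (field; lra).
            nra. }
        apply exp_le_compat in hg. rewrite exp_0 in hg.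
        match type of hg with ?e <= 1 =>
          match goal with |- 0 <= ?a =>
            replace a with ((2 * N * C * k) * (1 - e)) by ring end end.
        apply Rmult_le_pos; lra. }
    assert (hl := quadratic_primitive_increment y hy).
    apply (Rmult_le_compat_l (2 * N * C)) in hl;
      [ | apply Rlt_le, hNC].
    replace (2 * N * C * ((y ^ 2 - 1) ^ 2 * (1 - / y) / 6))
      with (C * (1 - / y) / (3 * N)) in hl; [lra | ].
    rewrite hy2. field. lra.
Qed.

Lemma stieltjes_error_step_bounds (m : nat) :
  let N := INR (S m) in
  let d := / sqrt N - / sqrt (N + 1) in
  sqrt (2 * PI) * exp (1 / (12 * N + 1) - 1 / (8 * N)) / 3 * d
    <= stieltjes_error_seq (S m) - stieltjes_error_seq (S (S m))
    <= sqrt (2 * PI) * exp (1 / (12 * N)) / 3 * d.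
Proof.
  intros N d. rewrite stieltjes_error_step. fold N.
  assert (hN : 1 <= N) by (apply (le_INR 1); lia).
  assert (b := error_primitive_increment_bounds m). cbv zeta in b. fold N in b.
  assert (s := stirling_bounds (S m) ltac:(lia)). fold N in s.
  set (C := INR (fact (S m)) * exp N / N ^ S m) in *.
  set (D := error_primitive m (N + 1) - error_primitive m N) in *.
  assert (hs : 0 < sqrt N) by (apply sqrt_lt_R0; lra).
  assert (hsN : sqrt N * sqrt N = N) by (apply sqrt_sqrt; lra).
  assert (hs1 : sqrt N < sqrt (N + 1)) by (apply sqrt_lt_1; lra).
  (* Since [1 - / y = sqrt N * d], a factor [/ sqrt N] survives and cancels the [sqrt N] of
     Stirling's formula. *)
  assert (hd : (1 - / sqrt (1 + / N)) / (3 * N) = d / (3 * sqrt N)).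
  { unfold d. replace (1 + / N) with ((N + 1) / N) by (field; lra).
    rewrite sqrt_div_alt by lra. rewrite <- hsN at 3. field. lra. }
  assert (hy : 0 < sqrt (1 + / N)).
  { apply sqrt_lt_R0. assert (0 < / N) by (apply Rinv_0_lt_compat; lra). lra. }
  assert (hd0 : 0 <= d / (3 * sqrt N)).
  { unfold d. apply Rdiv_le_0_compat; [ | lra].
    assert (/ sqrt (N + 1) <= / sqrt N) by (apply Rinv_le_contravar; lra). lra. }
  replace (C * exp (- (1 / (8 * N))) * (1 - / sqrt (1 + / N)) / (3 * N))
    with (C * (exp (- (1 / (8 * N))) * (d / (3 * sqrt N)))) in b
    by (rewrite <- hd; field; lra).
  replace (C * (1 - / sqrt (1 + / N)) / (3 * N)) with (C * (d / (3 * sqrt N))) in b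
    by (rewrite <- hd; field; lra).
  split.
  - refine (Rle_trans _ _ _ _ (proj1 b)).
    assert (h := Rmult_le_compat_r (exp (- (1 / (8 * N))) * (d / (3 * sqrt N))) _ _
      (Rmult_le_pos _ _ (Rlt_le _ _ (exp_pos _)) hd0) (proj1 s)).
    refine (Rle_trans _ _ _ _ h). apply Req_le.
    unfold Rminus at 1. rewrite exp_plus. field. lra.
  - refine (Rle_trans _ _ _ (proj2 b) _).
    assert (h := Rmult_le_compat_r _ _ _ hd0 (proj2 s)).
    refine (Rle_trans _ _ _ h _). apply Req_le. field. lra.
Qed.

(** The differences [d] telescope over the steps, while each exponential is replaced by its value at
    [s], the extreme one in both bounds. *)
Lemma stieltjes_error_diff_bounds (n s : nat) : (1 <= s)%nat -> (s <= n)%nat ->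
  let d := / sqrt (INR s) - / sqrt (INR n) in
  sqrt (2 * PI) * exp (1 / (12 * INR s + 1) - 1 / (8 * INR s)) / 3 * d
    <= stieltjes_error_seq s - stieltjes_error_seq n
    <= sqrt (2 * PI) * exp (1 / (12 * INR s)) / 3 * d.
Proof.
  intros hs hsn. induction hsn as [|n hsn IH].
  - cbv zeta. rewrite !Rminus_diag. lra.
  - cbv zeta in *. destruct n as [|m]; [lia | ].
    assert (h := stieltjes_error_step_bounds m). cbv zeta in h.
    rewrite <- S_INR in h.
    assert (hs1 : 1 <= INR s) by (apply (le_INR 1); lia).
    apply le_INR in hsn.
    set (a := INR s) in *. set (b := INR (S m)) in *.
    assert (hb : INR (S (S m)) = b + 1) by apply S_INR. rewrite hb in *.
    assert (hsq : 0 < sqrt b) by (apply sqrt_lt_R0; lra).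
    assert (hd : 0 <= sqrt (2 * PI) / 3 * (/ sqrt b - / sqrt (b + 1))).
    { assert (/ sqrt (b + 1) <= / sqrt b) by (apply Rinv_le_contravar, sqrt_le_1; lra).
      assert (0 <= sqrt (2 * PI)) by apply sqrt_pos. nra. }
    assert (e1 : exp (1 / (12 * b)) <= exp (1 / (12 * a))).
    { apply exp_le_compat, Rmult_le_compat_l, Rinv_le_contravar; lra. }
    (* The exponent [1/(12x + 1) - 1/(8x) = - (4x + 1) / (8x (12x + 1))] increases with [x > 0]. *)
    assert (e2 : exp (1 / (12 * a + 1) - 1 / (8 * a)) <= exp (1 / (12 * b + 1) - 1 / (8 * b))).
    { apply exp_le_compat.
      enough (0 <= (b - a) * (48 * a * b + 12 * (a + b) + 1)
                   / (8 * a * b * (12 * a + 1) * (12 * b + 1))) as h0.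
      { match type of h0 with 0 <= ?q => replace q with
          (1 / (12 * b + 1) - 1 / (8 * b) - (1 / (12 * a + 1) - 1 / (8 * a)))
          in h0 by (field; lra) end. lra. }
      apply Rdiv_le_0_compat; [apply Rmult_le_pos; nra | ].
      repeat apply Rmult_lt_0_compat; lra. }
    apply (Rmult_le_compat_l _ _ _ hd) in e1. apply (Rmult_le_compat_l _ _ _ hd) in e2.
    split; lra.
Qed.

Theorem proposition4 (n s : nat) (hs : (1 <= s)%nat) (hsn : (s <= n)%nat) :
  stieltjes_error_seq s
    - sqrt (2 * PI) * exp (1 / (12 * INR s)) / (3 * sqrt (INR s))
    + sqrt (2 * PI) * exp (1 / (12 * INR s)) / (3 * sqrt (INR n))
    <= stieltjes_error_seq n
  /\
  stieltjes_error_seq n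
    <= stieltjes_error_seq s
       - sqrt (2 * PI) * exp (1 / (12 * INR s + 1) - 1 / (8 * INR s))
         / (3 * sqrt (INR s))
       + sqrt (2 * PI) * exp (1 / (12 * INR s + 1) - 1 / (8 * INR s))
         / (3 * sqrt (INR n)).
Proof.
  assert (b := stieltjes_error_diff_bounds n s hs hsn). cbv zeta in b.
  assert (0 < sqrt (INR s)) by (apply sqrt_lt_R0, lt_0_INR; lia).
  assert (0 < sqrt (INR n)) by (apply sqrt_lt_R0, lt_0_INR; lia).
  assert (e : forall a, a / (3 * sqrt (INR s)) - a / (3 * sqrt (INR n))
                        = a / 3 * (/ sqrt (INR s) - / sqrt (INR n))).
  { intros a. field. lra. }
  assert (e1 := e (sqrt (2 * PI) * exp (1 / (12 * INR s)))).
  assert (e2 := e (sqrt (2 * PI) * exp (1 / (12 * INR s + 1) - 1 / (8 * INR s)))).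
  split; lra.
Qed.
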